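(* For every compact Hausdorff space $X$ there exist a zero-dimensional compact Hausdorff space $Z$ and a max-min Milyutin map $f\colon Z\to X$.
   Context: A max-min measure on a compact Hausdorff space $X$ is a functional $\mu\colon C(X)\to\mathbb R$ (not assumed continuous) such that $\mu(c_X)=c$ for constants $c$, $\mu(\varphi\vee\psi)=\mu(\varphi)\vee\mu(\psi)$, and $\mu(c\wedge\varphi)=c\wedge\mu(\varphi)$ for $c\in\mathbb R$. $J(X)$ is the set of max-min measures with the topology of pointwise convergence on $C(X)$; for continuous $f\colon X\to Y$, $J(f)(\mu)(\varphi)=\mu(\varphi\circ f)$. For a closed subset $A\subset X$, $J(A)$ is identified with its image $J(i)(J(A))\subset J(X)$ under the inclusion $i\colon A\to X$. A continuous surjection $f\colon Z\to X$ of compact Hausdorff spaces is a max-min Milyutin map if there exists a continuous map $s\colon X\to J(Z)$ with $s(x)\in J(f^{-1}(x))\subset J(Z)$ for every $x\in X$. A space is zero-dimensional if it has a base of clopen sets. *)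

(* Defs.v *)
From Stdlib Require Import Reals List.
Open Scope R_scope.

Definition is_topology {X : Type} (op : (X -> Prop) -> Prop) : Prop :=
  op (fun _ => True) /\
  (forall F : (X -> Prop) -> Prop, (forall U, F U -> op U) ->
     op (fun x => exists U, F U /\ U x)) /\
  (forall U V, op U -> op V -> op (fun x => U x /\ V x)).

Definition compact_sp {X : Type} (op : (X -> Prop) -> Prop) : Prop :=
  forall F : (X -> Prop) -> Prop,
    (forall U, F U -> op U) -> (forall x, exists U, F U /\ U x) ->
    exists l : list (X -> Prop),
      (forall U, In U l -> F U) /\ (forall x, exists U, In U l /\ U x).

Definition hausdorff {X : Type} (op : (X -> Prop) -> Prop) : Prop :=
  forall x y : X, x <> y ->
    exists U V, op U /\ op V /\ U x /\ V y /\ (forall z, U z -> V z -> False).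

Definition clopen {X : Type} (op : (X -> Prop) -> Prop) (V : X -> Prop) : Prop :=
  op V /\ op (fun x => ~ V x).

Definition zero_dimensional {X : Type} (op : (X -> Prop) -> Prop) : Prop :=
  forall U, op U -> forall x, U x ->
    exists V, clopen op V /\ V x /\ (forall y, V y -> U y).

Definition continuous {X Y : Type} (opX : (X -> Prop) -> Prop)
  (opY : (Y -> Prop) -> Prop) (f : X -> Y) : Prop :=
  forall U, opY U -> opX (fun x => U (f x)).

Definition R_open (U : R -> Prop) : Prop :=
  forall x, U x -> exists eps, 0 < eps /\ forall y, Rabs (y - x) < eps -> U y.

Definition C {X : Type} (op : (X -> Prop) -> Prop) : Type :=
  { phi : X -> R | continuous op R_open phi }.

(* Max-min measures. The operations phi \/ psi, c /\ phi, c_X are expressed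
   relationally (the resulting functions are continuous elements of C(X)). *)
Definition is_maxmin {X : Type} (op : (X -> Prop) -> Prop) (mu : C op -> R) : Prop :=
  (forall (c : R) (phi : C op), (forall x, proj1_sig phi x = c) -> mu phi = c) /\
  (forall phi psi chi : C op,
     (forall x, proj1_sig chi x = Rmax (proj1_sig phi x) (proj1_sig psi x)) ->
     mu chi = Rmax (mu phi) (mu psi)) /\
  (forall (c : R) (phi chi : C op),
     (forall x, proj1_sig chi x = Rmin c (proj1_sig phi x)) ->
     mu chi = Rmin c (mu phi)).

Definition J {X : Type} (op : (X -> Prop) -> Prop) : Type :=
  { mu : C op -> R | is_maxmin op mu }.

(* Topology of pointwise convergence on J(X): generated by the subbasic sets
   { mu | mu(phi) in U }, phi in C(X), U open in R. *)
Definition J_open {X : Type} (op : (X -> Prop) -> Prop) (W : J op -> Prop) : Prop :=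
  forall mu : J op, W mu ->
    exists l : list (C op * (R -> Prop)),
      (forall p, In p l -> R_open (snd p) /\ snd p (proj1_sig mu (fst p))) /\
      (forall nu : J op, (forall p, In p l -> snd p (proj1_sig nu (fst p))) -> W nu).

Definition sub_open {X : Type} (op : (X -> Prop) -> Prop) (A : X -> Prop)
  (V : {x | A x} -> Prop) : Prop :=
  exists U, op U /\ forall a : {x | A x}, V a <-> U (proj1_sig a).

(* mu belongs to J(A) ⊂ J(X), i.e. mu = J(i)(nu) for some nu in J(A),
   where i : A -> X is the inclusion: mu(phi) = nu(phi o i). *)
Definition in_J_sub {X : Type} (op : (X -> Prop) -> Prop) (A : X -> Prop)
  (mu : J op) : Prop :=
  exists nu : J (sub_open op A),
    forall (phi : C op) (psi : C (sub_open op A)),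
      (forall a, proj1_sig psi a = proj1_sig phi (proj1_sig a)) ->
      proj1_sig mu phi = proj1_sig nu psi.

Definition surjective {Z X : Type} (f : Z -> X) : Prop := forall x, exists z, f z = x.

Definition maxmin_milyutin {Z X : Type} (opZ : (Z -> Prop) -> Prop)
  (opX : (X -> Prop) -> Prop) (f : Z -> X) : Prop :=
  continuous opZ opX f /\ surjective f /\
  exists s : X -> J opZ,
    continuous opX (J_open opZ) s /\
    forall x, in_J_sub opZ (fun z => f z = x) (s x).

(* Main.v *)
(** The codes [b] assign a bit to every continuous real function [g] on [X]; the
    cover consists of the pairs [(x, b)] with [g x >= -1] when [b g] is true and
    [g x <= 1] when it is false.  By Urysohn a code determines its point, so the
    cover is a compact subspace of a Cantor cube.  The measure over [x] has as
    density the infimum over [g] of one-bit densities that depend continuously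
    on [g x], equal [-oo] where the bit is forbidden, and are chosen so that for
    every [x] the bit [0 <= g x] can be taken at no cost.  A continuous function
    on the cover depends, up to [e], on finitely many bits only, and all the
    other bits can be reset to this free choice when [x] moves; hence the
    measure varies continuously with [x]. *)

From Stdlib Require Import Reals List Lra ClassicalEpsilon.
From Stdlib Require Import FunctionalExtensionality PropExtensionality.
Require Import Defs.
From HB Require structures.
From mathcomp Require all_boot all_order all_algebra all_classical.
From mathcomp Require all_reals topology normedtype Rstruct Rstruct_topology.

(** * Ultrafilter compactness and Urysohn functions *)

Module Topology.

Import HB.structures.
Import all_boot all_order all_algebra all_classical.
Import all_reals topology normedtype Rstruct Rstruct_topology.
Import Order.TTheory GRing.Theory Num.Theory numFieldNormedType.Exports.
Local Open Scope classical_set_scope.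

Section Carrier.
Variables (X : Type) (op : (X -> Prop) -> Prop) (top : is_topology op).

(** An alias of [X] indexed by the proof [top], so that the structures declared below find [op] and
    its axioms from the type alone. *)
Definition carrier of is_topology op : Type := X.
Local Notation T := (carrier top).

HB.instance Definition _ := gen_eqMixin T.
HB.instance Definition _ := gen_choiceMixin T.

Let opI : setI_closed (op : set_system T).
Proof. by move=> U V oU oV; apply: top.2.2. Qed.

Let op_bigU (I : Type) (f : I -> set T) :
  (forall i, op (f i)) -> op (\bigcup_i f i).
Proof.
move=> opf; have opU := top.2.1.
have := opU [set U | exists i, U = f i] _.
rewrite (_ : (fun x => _) = \bigcup_i f i); first by apply=> _ [i ->].
apply/seteqP; split=> [x [_ [[i ->] fx]]|x [i _ fx]]; first by exists i.
by exists (f i); split=> //; exists i.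
Qed.

HB.instance Definition _ := @isOpenTopological.Build T op top.1 opI op_bigU.

End Carrier.
Arguments carrier {X op}.

(** Otherwise each point has an open neighbourhood whose preimage is not in [G]. Finitely many of
    them cover [X], and the complements of their preimages lie in the ultrafilter but have empty
    intersection. *)
Lemma compact_ultra_limit (Z X : Type) (op : (X -> Prop) -> Prop) (f : Z -> X)
  (G : set_system Z) :
  compact_sp op -> UltraFilter G ->
  exists x, forall V, op V -> V x -> G (f @^-1` V).
Proof.
move=> cpt GU; apply: contrapT => /forallNP noLim.
have [|x|l [lF lcov]] := cpt (fun V => op V /\ ~ G (f @^-1` V)).
- by move=> U [].
- by have /existsNP[V /not_implyP[oV /not_implyP[Vx nGV]]] := noLim x; exists V.
suff: G set0 by exact: filter_not_empty.
have : G (fun z => ~ exists U, In U l /\ U (f z)).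
  elim: l lF {lcov} => [|V l IH] lF.
    by apply: filterS filterT => z _ [U []].
  have GV : G (~` (f @^-1` V)).
    by have [/(lF V (or_introl erefl)).2|] := in_ultra_setVsetC (f @^-1` V) GU.
  have {}IH := IH (fun U lU => lF U (or_intror lU)).
  apply: filterS (filterI GV IH) => z [nVz nlz] [U [[<-//|lU] Uz]].
  by apply: nlz; exists U.
by apply: filterS => z; apply; exact: lcov.
Qed.

(** If no finite subfamily of [F] covers, the sets whose complement is finitely covered form a
    proper filter. A finer ultrafilter with a limit [x] would contain both a member of [F] around
    [x] and its complement. *)
Lemma compact_of_ultra_limit (X : Type) (op : (X -> Prop) -> Prop) :
  (forall G : set_system X, UltraFilter G ->
     exists x, forall V, op V -> V x -> G V) ->
  compact_sp op.
Proof.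
move=> lim F Fop Fcov; apply: contrapT => noCov.
pose Fil : set_system X := fun A => exists l : list (X -> Prop),
  (forall U, In U l -> F U) /\ forall z, ~ A z -> exists U, In U l /\ U z.
have FilP : ProperFilter Fil.
  split=> [[l [lF lcov]]|].
    by apply: noCov; exists l; split=> // x; exact: lcov.
  split=> [|A B [l [lF lcov]] [k [kF kcov]]|A B AB [l [lF lcov]]].
  - by exists nil; split=> [U []|z []].
  - exists (l ++ k)%list; split=> [U /in_app_iff[/lF|/kF]//|z /not_andP[]].
    + by move=> /lcov[U [lU Uz]]; exists U; split=> //; apply/in_app_iff; left.
    + by move=> /kcov[U [kU Uz]]; exists U; split=> //; apply/in_app_iff; right.
  - by exists l; split=> // z nB; apply: lcov => /AB.
have [G [GU FilG]] := ultraFilterLemma FilP.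
have [x limx] := lim G GU.
have [U [FU Ux]] := Fcov x.
have GU' : G U by exact: limx (Fop U FU) Ux.
have GcU : G (~` U).
  apply: FilG; exists (U :: nil)%list; split=> [V [<-//|[]]|z /contrapT Uz].
  by exists U; split=> //; left.
suff: G set0 by exact: filter_not_empty.
by rewrite -(setICr U); exact: filterI.
Qed.

(** A compact Hausdorff space is normal and its points are closed, so the Urysohn lemma applies to
    two singletons. *)
Lemma urysohn_points (X : Type) (op : (X -> Prop) -> Prop) :
  is_topology op -> compact_sp op -> hausdorff op ->
  forall x y : X, x <> y -> exists g : X -> R,
    Defs.continuous op R_open g /\ g x = IZR 0 /\ g y = IZR 1.
Proof.
move=> top cpt haus x y xy; set T := carrier top.
have hT : hausdorff_space T.
  rewrite open_hausdorff => a b /eqP/haus[U [V [oU [oV [Ua [Vb UV]]]]]].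
  exists (U, V); first by split; apply/mem_set.
  split=> //=.
  by apply/eqP; rewrite -subset0 => z [Uz Vz]; exact: (UV z).
have cT : compact [set: T].
  rewrite compact_ultra => G GU _.
  have [z limz] := compact_ultra_limit T X op id G cpt GU.
  exists z; split=> //= A; rewrite nbhsE => -[B [oB Bz] BA].
  by apply: filterS BA _; exact: limz.
have clT (z : T) : closed [set z] by apply: accessible_closed_set1; exact: hausdorff_accessible.
have := compact_normal hT cT => /(normal_separatorP (R := R)) sep.
have [|g [gc _ gx gy]] := (uniform_separatorP (R := R) [set (x : T)] [set (y : T)]).1.
  by apply: sep => //; apply/seteqP; split=> // z [/= -> /xy].
exists g; split; last by split; [apply: gx; exists x|apply: gy; exists y].
move=> U oU.
have : open (g @^-1` U).
  apply: open_comp => [z _|]; first exact: gc.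
  rewrite openE => z /oU[e [e0 eU]]; apply/nbhs_ballP; exists e; first exact/RltP.
  move=> w; rewrite /ball /= => zw; apply: eU.
  by rewrite RabsE RminusE distrC; exact/RltP.
by [].
Qed.

End Topology.

(** * Open sets, compactness and bounded functions *)

Lemma pred_ext {A : Type} (P Q : A -> Prop) : (forall a, P a <-> Q a) -> P = Q.
Proof.
  intros H. apply functional_extensionality. intros a.
  now apply propositional_extensionality.
Qed.

Lemma open_of_local {X : Type} (op : (X -> Prop) -> Prop) (P : X -> Prop) :
  is_topology op ->
  (forall x, P x -> exists V, op V /\ V x /\ forall y, V y -> P y) -> op P.
Proof.
  intros [_ [union _]] loc.
  replace P with (fun x => exists U, (op U /\ forall y, U y -> P y) /\ U x).
  - apply union. now intros U [oU _].
  - apply pred_ext. intros x. split.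
    + intros [U [[_ UP] Ux]]. now apply UP.
    + intros Px. destruct (loc x Px) as [V [oV [Vx VP]]]. now exists V.
Qed.

Lemma open_finite_inter {X I : Type} (op : (X -> Prop) -> Prop)
  (U : I -> X -> Prop) (l : list I) :
  is_topology op -> (forall i, op (U i)) -> op (fun x => forall i, In i l -> U i x).
Proof.
  intros top oU. induction l as [|i l IH].
  - replace (fun x => forall i, In i nil -> U i x) with (fun _ : X => True).
    + apply top.
    + apply pred_ext. intros x. split; [intros _ i [] | easy].
  - replace (fun x => forall j, In j (i :: l) -> U j x)
      with (fun x => U i x /\ forall j, In j l -> U j x).
    + now apply top.
    + apply pred_ext. intros x. split.
      * intros [Ui Ul] j [<-|lj]; auto.
      * intros H. split; [apply H; now left | intros j lj; apply H; now right].
Qed.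

(** Indices are returned instead of sets, because they carry the data used later: radii, functions,
    points of the cover. *)
Lemma compact_finite_subfamily {X I : Type} (op : (X -> Prop) -> Prop)
  (U : I -> X -> Prop) :
  compact_sp op -> (forall i, op (U i)) -> (forall x, exists i, U i x) ->
  exists l : list I, forall x, exists i, In i l /\ U i x.
Proof.
  intros cpt oU cov.
  destruct (cpt (fun V => exists i, V = U i)) as [l [lF lcov]].
  - now intros V [i ->].
  - intros x. destruct (cov x) as [i Ui]. exists (U i). split; eauto.
  - assert (idx : exists k : list I, forall V, In V l -> exists i, In i k /\ V = U i).
    { clear lcov. induction l as [|V l IH].
      - exists nil. intros V [].
      - destruct IH as [k kl]. { intros W lW. apply lF. now right. }
        destruct (lF V) as [i Vi]. { now left. }
        exists (i :: k). intros W [<-|lW].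
        + exists i. split; [now left | easy].
        + destruct (kl W lW) as [j [kj Wj]]. exists j. split; [now right | easy]. }
    destruct idx as [k kl]. exists k. intros x.
    destruct (lcov x) as [V [lV Vx]]. destruct (kl V lV) as [i [ki ->]]. eauto.
Qed.

Lemma compact_subspace {X : Type} (op : (X -> Prop) -> Prop) (A : X -> Prop) :
  compact_sp op -> op (fun x => ~ A x) -> compact_sp (sub_open op A).
Proof.
  intros cpt cA F Fop Fcov.
  pose (trace := fun (U : X -> Prop) (a : {x | A x}) => U (proj1_sig a)).
  (* The ambient cover consists of the open sets whose trace is in [F] and the open sets disjoint
     from [A]; the latter add nothing to the subcover of [A]. *)
  destruct (cpt (fun U => op U /\ (F (trace U) \/ forall x, U x -> ~ A x)))
    as [l [lF lcov]].
  - now intros U [oU _].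
  - intros x. destruct (classic (A x)) as [Ax|nAx].
    + destruct (Fcov (exist _ x Ax)) as [V [FV Vx]].
      destruct (Fop V FV) as [U [oU VU]].
      exists U. split; [split; [easy | left] | now apply (VU (exist _ x Ax))].
      replace (trace U) with V; [easy|]. apply pred_ext, VU.
    + exists (fun x => ~ A x). split; [split; [easy | now right] | easy].
  - assert (sub : exists k, (forall V, In V k -> F V) /\
      forall U, In U l -> forall a, trace U a -> exists V, In V k /\ V a).
    { clear lcov. induction l as [|U l IH].
      - exists nil. split; [intros V [] | intros U []].
      - destruct IH as [k [kF kcov]]. { intros W lW. apply lF. now right. }
        destruct (lF U) as [_ [FU|UA]]. { now left. }
        + exists (trace U :: k). split.
          * intros V [<-|kV]; auto.
          * intros W [<-|lW] a Wa.
            -- exists (trace U). split; [now left | easy].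
            -- destruct (kcov W lW a Wa) as [V [kV Va]].
               exists V. split; [now right | easy].
        + exists k. split; [easy|]. intros W [<-|lW] a Wa.
          * destruct (UA _ Wa (proj2_sig a)).
          * eauto. }
    destruct sub as [k [kF kcov]]. exists k. split; [easy|].
    intros a. destruct (lcov (proj1_sig a)) as [U [lU Ua]]. eauto.
Qed.

Lemma R_open_lt (a : R) : R_open (fun y => y < a).
Proof.
  intros x xa. exists (a - x). split; [lra|].
  intros y xy. apply Rabs_def2 in xy. lra.
Qed.

Lemma R_open_gt (a : R) : R_open (fun y => a < y).
Proof.
  intros x xa. exists (x - a). split; [lra|].
  intros y xy. apply Rabs_def2 in xy. lra.
Qed.

Lemma R_open_ball (a r : R) : R_open (fun y => Rabs (y - a) < r).
Proof.
  intros x xa. exists (r - Rabs (x - a)). split; [lra|].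
  intros y xy. replace (y - a) with ((y - x) + (x - a)) by ring.
  eapply Rle_lt_trans; [apply Rabs_triang | lra].
Qed.

Lemma compact_bounded {X : Type} (op : (X -> Prop) -> Prop) (phi : C op) :
  compact_sp op -> exists M, forall x, Rabs (proj1_sig phi x) <= M.
Proof.
  intros cpt.
  destruct (compact_finite_subfamily op
    (fun r x => Rabs (proj1_sig phi x - 0) < r) cpt) as [l lcov].
  - intros r. apply (proj2_sig phi (fun y => Rabs (y - 0) < r)), R_open_ball.
  - intros x. eexists. apply Rlt_plus_1.
  - assert (ub : exists M, forall r, In r l -> r <= M).
    { clear. induction l as [|r l [M HM]].
      - exists 0. intros r [].
      - exists (Rmax r M). intros s [<-|ls]; [apply Rmax_l|].
        eapply Rle_trans; [now apply HM | apply Rmax_r]. }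
    destruct ub as [M HM]. exists M. intros x.
    destruct (lcov x) as [r [lr rx]]. rewrite Rminus_0_r in rx.
    specialize (HM r lr). lra.
Qed.

(** * Max-min measures given by a density *)

(* [lev c y] stands for c <= lambda y, where lambda : Y -> [-oo, +oo] is the
   density of the measure phi |-> sup_y min (lambda y) (phi y). *)
Section DensityMeasure.

Context {Y : Type} (op : (Y -> Prop) -> Prop) (lev : R -> Y -> Prop).
Hypothesis cpt : compact_sp op.
Hypothesis lev_anti : forall c c' y, c' <= c -> lev c y -> lev c' y.
(** The density has supremum +oo, which is why constants are preserved. *)
Hypothesis lev_inh : forall c, exists y, lev c y.

Definition density_hypo (phi : Y -> R) (c : R) : Prop :=
  exists y, lev c y /\ c <= phi y.

Lemma density_hypo_down phi c c' :
  c' <= c -> density_hypo phi c -> density_hypo phi c'.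
Proof.
  intros cc [y [ly cy]]. exists y. split; [eauto | lra].
Qed.

Lemma density_hypo_bound (phi : C op) : bound (density_hypo (proj1_sig phi)).
Proof.
  destruct (compact_bounded op phi cpt) as [M HM].
  exists M. intros c [y [_ cy]].
  specialize (HM y). assert (H := Rle_abs (proj1_sig phi y)). lra.
Qed.

Lemma density_hypo_inh (phi : C op) : exists c, density_hypo (proj1_sig phi) c.
Proof.
  destruct (compact_bounded op phi cpt) as [M HM].
  destruct (lev_inh (- M)) as [y ly]. exists (- M), y. split; [easy|].
  specialize (HM y). assert (H := Rle_abs (- proj1_sig phi y)).
  rewrite Rabs_Ropp in H. lra.
Qed.

Definition density_sup (phi : C op) : R :=
  proj1_sig (completeness _ (density_hypo_bound phi) (density_hypo_inh phi)).

Lemma density_sup_lub phi : is_lub (density_hypo (proj1_sig phi)) (density_sup phi).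
Proof. unfold density_sup. apply proj2_sig. Qed.

(** The supremum is not claimed to be attained, but downward closure gives every strictly smaller
    value. *)
Lemma density_hypo_below phi c :
  c < density_sup phi -> density_hypo (proj1_sig phi) c.
Proof.
  intros lt. apply NNPP. intros nc.
  apply (Rlt_not_le _ _ lt), (density_sup_lub phi). intros d hd.
  apply Rnot_lt_le. intros cd. apply nc. eapply density_hypo_down; [|exact hd]. lra.
Qed.

Lemma density_sup_ge phi c : density_hypo (proj1_sig phi) c -> c <= density_sup phi.
Proof. apply (density_sup_lub phi). Qed.

Lemma density_sup_maxmin : is_maxmin op density_sup.
Proof.
  split; [|split].
  - intros c phi phic. apply is_lub_u with (density_hypo (proj1_sig phi)).
    + apply density_sup_lub.
    + split.
      * intros d [y [_ dy]]. now rewrite phic in dy.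
      * intros b ub. apply ub. destruct (lev_inh c) as [y ly].
        exists y. split; [easy|]. rewrite phic. lra.
  - intros phi psi chi chiE. apply is_lub_u with (density_hypo (proj1_sig chi)).
    + apply density_sup_lub.
    + split.
      * intros d [y [ly dy]]. rewrite chiE in dy. apply Rmax_Rle in dy.
        apply Rmax_Rle.
        destruct dy; [left | right]; apply density_sup_ge; now exists y.
      * intros b ub. apply Rmax_lub; apply density_sup_lub; intros d [y [ly dy]];
          apply ub; exists y; (split; [easy|]); rewrite chiE; apply Rmax_Rle; auto.
  - intros c phi chi chiE. apply is_lub_u with (density_hypo (proj1_sig chi)).
    + apply density_sup_lub.
    + split.
      * intros d [y [ly dy]]. rewrite chiE in dy. apply Rmin_glb.
        -- eapply Rle_trans; [exact dy | apply Rmin_l].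
        -- apply density_sup_ge. exists y. split; [easy|].
           eapply Rle_trans; [exact dy | apply Rmin_r].
      * intros b ub. apply Rnot_lt_le. intros lt.
        (* The midpoint lies strictly below both [c] and the supremum for [phi], so it belongs to
           the set for [chi] although it exceeds the upper bound [b]. *)
        pose (d := (b + Rmin c (density_sup phi)) / 2).
        assert (Hc := Rmin_l c (density_sup phi)).
        assert (Hs := Rmin_r c (density_sup phi)).
        assert (d <= b); [|unfold d in *; lra].
        apply ub.
        destruct (density_hypo_below phi d) as [y [ly dy]]; [unfold d; lra|].
        exists y. split; [easy|]. rewrite chiE. apply Rmin_glb; [unfold d; lra | easy].
Qed.

Definition density_measure : J op := exist _ density_sup density_sup_maxmin.

End DensityMeasure.

(** No point outside [A] has any level, so restricting the density to [A] leaves the set of values,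
    hence its supremum, unchanged. *)
Lemma density_measure_support {Y : Type} (op : (Y -> Prop) -> Prop)
  (lev : R -> Y -> Prop) cpt lev_anti lev_inh (A : Y -> Prop) :
  op (fun y => ~ A y) -> (forall c y, lev c y -> A y) ->
  in_J_sub op A (density_measure op lev cpt lev_anti lev_inh).
Proof.
  intros cA levA.
  assert (inh : forall c, exists a : {y | A y}, lev c (proj1_sig a)).
  { intros c. destruct (lev_inh c) as [y ly].
    now exists (exist _ y (levA c y ly)). }
  exists (density_measure (sub_open op A) (fun c a => lev c (proj1_sig a))
    (compact_subspace op A cpt cA) (fun c c' a => lev_anti c c' (proj1_sig a)) inh).
  intros phi psi psiE. simpl.
  apply is_lub_u with (density_hypo lev (proj1_sig phi)); [apply density_sup_lub|].
  replace (density_hypo lev (proj1_sig phi))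
    with (density_hypo (fun c (a : {y | A y}) => lev c (proj1_sig a)) (proj1_sig psi)).
  - apply density_sup_lub.
  - apply pred_ext. intros c. split.
    + intros [a [la ca]]. exists (proj1_sig a). now rewrite <- psiE.
    + intros [y [ly cy]]. exists (exist _ y (levA c y ly)). now rewrite psiE.
Qed.

Lemma continuous_to_J {X Z : Type} (opX : (X -> Prop) -> Prop)
  (opZ : (Z -> Prop) -> Prop) (s : X -> J opZ) :
  is_topology opX ->
  (forall phi, continuous opX R_open (fun x => proj1_sig (s x) phi)) ->
  continuous opX (J_open opZ) s.
Proof.
  intros top cts W oW. apply open_of_local; [easy|]. intros x Wx.
  destruct (oW (s x) Wx) as [l [lop lW]].
  (* The guard [R_open (snd p)] makes the condition open for every [p], in [l] or not, as
     [open_finite_inter] asks. *)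
  exists (fun y => forall p, In p l -> R_open (snd p) -> snd p (proj1_sig (s y) (fst p))).
  split; [|split].
  - apply (open_finite_inter opX
      (fun p y => R_open (snd p) -> snd p (proj1_sig (s y) (fst p)))); [easy|].
    intros p. apply open_of_local; [easy|]. intros y Hy.
    destruct (classic (R_open (snd p))) as [o|no].
    + exists (fun y => snd p (proj1_sig (s y) (fst p))).
      split; [now apply (cts (fst p) (snd p)) | split; auto].
    + exists (fun _ => True). split; [apply top | split; [easy|]]. tauto.
  - intros p lp _. now apply lop.
  - intros y Hy. apply lW. intros p lp. apply Hy; [easy | now apply lop].
Qed.

(** * Points, codes and the cover *)

Section Construction.

Context {X : Type} (opX : (X -> Prop) -> Prop).
Hypothesis topX : is_topology opX.
Hypothesis cptX : compact_sp opX.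
Hypothesis hausX : hausdorff opX.

Lemma continuous_open_ball (g : C opX) (a r : R) :
  opX (fun y => Rabs (proj1_sig g y - a) < r).
Proof. apply (proj2_sig g (fun y => Rabs (y - a) < r)), R_open_ball. Qed.

(** The Urysohn function is rescaled to the values -2 and 2, so that the cover forces the bit false
    at [x] and true at [y]. *)
Lemma separating_function (x y : X) :
  x <> y -> exists g : C opX, proj1_sig g x < -1 /\ 1 < proj1_sig g y.
Proof.
  intros xy.
  destruct (Topology.urysohn_points X opX topX cptX hausX x y xy)
    as [g [gc [gx gy]]].
  assert (hc : continuous opX R_open (fun z => 4 * g z - 2)).
  { intros U oU. apply (gc (fun r => U (4 * r - 2))). intros r Ur.
    destruct (oU _ Ur) as [e [e0 eU]]. exists (e / 4). split; [lra|].
    intros q qr. apply eU. apply Rabs_def2 in qr. apply Rabs_def1; lra. }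
  exists (exist _ _ hc). simpl. rewrite gx, gy. split; lra.
Qed.

(** A true bit claims that [g x] is nonnegative, a false one that it is nonpositive; [u] is the
    error allowed in each claim. *)
Definition level (u : R) (x : X) (b : C opX -> bool) : Prop :=
  forall g, if b g then - u <= proj1_sig g x else proj1_sig g x <= u.

Lemma level_mono u u' x b : u <= u' -> level u x b -> level u' x b.
Proof. intros uu H g. specialize (H g). destruct (b g); lra. Qed.

Definition sign_code (x : X) (g : C opX) : bool :=
  if Rle_dec 0 (proj1_sig g x) then true else false.

Lemma level_sign_code u x : 0 <= u -> level u x (sign_code x).
Proof. intros u0 g. unfold sign_code. destruct (Rle_dec _ _); lra. Qed.

(** On [l] the old bits survive, the extra slack absorbing the change of [g]; all other bits are
    reset to the sign code of [y], which needs no slack. *)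
Lemma level_patch u u' x y b (l : list (C opX)) :
  0 <= u' -> level u x b ->
  (forall g, In g l -> Rabs (proj1_sig g y - proj1_sig g x) < u' - u) ->
  exists b', level u' y b' /\ forall g, In g l -> b' g = b g.
Proof.
  intros u0 lev near.
  exists (fun g => if excluded_middle_informative (In g l) then b g else sign_code y g).
  split.
  - intros g. destruct (excluded_middle_informative (In g l)) as [lg|ng].
    + specialize (near g lg). apply Rabs_def2 in near.
      specialize (lev g). destruct (b g); lra.
    + now apply level_sign_code.
  - intros g lg. now destruct (excluded_middle_informative (In g l)).
Qed.

Definition cover : Type := { p : X * (C opX -> bool) | level 1 (fst p) (snd p) }.

Definition point (z : cover) : X := fst (proj1_sig z).
Definition code (z : cover) : C opX -> bool := snd (proj1_sig z).

Definition agree (l : list (C opX)) (z z' : cover) : Prop :=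
  forall g, In g l -> code z' g = code z g.

(* The topology comes from the codes alone: they already determine the point. *)
Definition cover_open (W : cover -> Prop) : Prop :=
  forall z, W z -> exists l, forall z', agree l z z' -> W z'.

Lemma cover_point_neq z z' : point z <> point z' -> exists g, code z g <> code z' g.
Proof.
  intros neq. destruct (separating_function _ _ neq) as [g [gz gz']].
  exists g. intros E.
  assert (H := proj2_sig z g). assert (H' := proj2_sig z' g).
  fold (code z) in H. fold (point z) in H. fold (code z') in H'. fold (point z') in H'.
  rewrite E in H. destruct (code z' g); lra.
Qed.

Lemma cover_neq z z' : z <> z' -> exists g, code z g <> code z' g.
Proof.
  intros neq. apply NNPP. intros same. apply neq.
  assert (same' : forall g, code z g = code z' g).
  { intros g. apply NNPP. eauto. }
  assert (P : point z = point z').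
  { apply NNPP. intros H. destruct (cover_point_neq z z' H) as [g Hg]. auto. }
  apply functional_extensionality in same'.
  destruct z as [[x b] H], z' as [[x' b'] H'].
  unfold code, point in *. simpl in *. subst. f_equal. apply proof_irrelevance.
Qed.

(** * Topology of the cover *)

Lemma agree_open l z : cover_open (agree l z).
Proof.
  intros z' H. exists l. intros z'' H' g lg. rewrite (H' g lg). auto.
Qed.

Lemma disagree_open l z : cover_open (fun z' => ~ agree l z z').
Proof.
  intros z' H. exists l. intros z'' H' A. apply H. intros g lg.
  rewrite <- (H' g lg). auto.
Qed.

Lemma agree_refl l z : agree l z z.
Proof. easy. Qed.

Lemma cover_topology : is_topology cover_open.
Proof.
  split; [|split].
  - intros z _. now exists nil.
  - intros F oF z [U [FU Uz]]. destruct (oF U FU z Uz) as [l Hl].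
    exists l. intros z' A. exists U. auto.
  - intros U V oU oV z [Uz Vz].
    destruct (oU z Uz) as [l Hl]. destruct (oV z Vz) as [k Hk].
    exists (l ++ k). intros z' A.
    split; [apply Hl | apply Hk]; intros g Hg; apply A, in_or_app; auto.
Qed.

Lemma cover_hausdorff : hausdorff cover_open.
Proof.
  intros z z' neq. destruct (cover_neq z z' neq) as [g Hg].
  exists (agree (g :: nil) z), (agree (g :: nil) z').
  repeat split; try apply agree_open.
  intros w A A'. apply Hg.
  rewrite <- (A g), <- (A' g); simpl; auto.
Qed.

Lemma cover_zero_dimensional : zero_dimensional cover_open.
Proof.
  intros U oU z Uz. destruct (oU z Uz) as [l Hl].
  exists (agree l z). repeat split; auto using agree_open, disagree_open.
Qed.

(** An ultrafilter converges to the limit of its points paired with the bitwise limit [b] of its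
    codes. *)
Lemma cover_compact : compact_sp cover_open.
Proof.
  apply Topology.compact_of_ultra_limit. intros G GU.
  pose proof GU as [[G0 [GT GI GS]] _].
  destruct (Topology.compact_ultra_limit cover X opX point G cptX GU) as [x limx].
  pose (b := fun g => if excluded_middle_informative (G (fun z => code z g = true))
                      then true else false).
  assert (Gb : forall g, G (fun z => code z g = b g)).
  { intros g. unfold b. destruct (excluded_middle_informative _) as [H|H]; [easy|].
    destruct (filter.in_ultra_setVsetC (fun z => code z g = true) GU) as [H'|H']; [easy|].
    apply (GS _ _ (fun z => Bool.not_true_is_false (code z g)) H'). }
  (* A bit forbidden at [x] stays forbidden on a neighbourhood of [x], hence on a member of [G],
     whereas [Gb] says that it is taken on a member of [G]. *)
  assert (lev : level 1 x b).
  { intros g. specialize (Gb g). destruct (b g) eqn:bg; apply Rnot_lt_le; intros lt; apply G0.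
    - assert (Gg := limx _ (proj2_sig g _ (R_open_lt (- (1)))) lt).
      apply (GS _ _) with (2 := GI _ _ Gb Gg). intros z [zg gz].
      assert (H := proj2_sig z g). fold (code z) in H. fold (point z) in H.
      rewrite zg in H. change (proj1_sig g (point z) < -1) in gz. lra.
    - assert (Gg := limx _ (proj2_sig g _ (R_open_gt 1)) lt).
      apply (GS _ _) with (2 := GI _ _ Gb Gg). intros z [zg gz].
      assert (H := proj2_sig z g). fold (code z) in H. fold (point z) in H.
      rewrite zg in H. change (1 < proj1_sig g (point z)) in gz. lra. }
  exists (exist _ (x, b) lev). intros W oW Wz. destruct (oW _ Wz) as [l Hl].
  apply (GS _ _ Hl). clear Hl. induction l as [|g l IH].
  - apply (GS (fun z => True)); [intros z _ g [] | exact GT].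
  - apply GS with (2 := GI _ _ (Gb g) IH). intros z [H A] h [<-|lh]; auto.
Qed.

(** A Lebesgue number argument with finite lists of functions as radii: [L] concatenates the lists
    of a finite subcover. *)
Lemma agree_finite_cover (l : cover -> list (C opX)) :
  exists L, forall z z', agree L z z' -> exists w, agree (l w) w z /\ agree (l w) w z'.
Proof.
  destruct (compact_finite_subfamily cover_open (fun w => agree (l w) w) cover_compact)
    as [k kcov].
  - intros w. apply agree_open.
  - intros z. exists z. apply agree_refl.
  - exists (flat_map l k). intros z z' A. destruct (kcov z) as [w [kw wz]].
    exists w. split; [easy|]. intros g lg. rewrite <- (wz g lg).
    apply A, in_flat_map. eauto.
Qed.

Lemma cover_uniform (phi : C cover_open) (e : R) :
  0 < e -> exists l, forall z z', agree l z z' ->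
    Rabs (proj1_sig phi z' - proj1_sig phi z) < e.
Proof.
  intros e0.
  assert (loc : forall w, exists l, forall z, agree l w z ->
    Rabs (proj1_sig phi z - proj1_sig phi w) < e / 2).
  { intros w. apply (proj2_sig phi _ (R_open_ball (proj1_sig phi w) (e / 2)) w).
    rewrite Rminus_diag, Rabs_R0. lra. }
  pose (l := fun w => proj1_sig (constructive_indefinite_description _ (loc w))).
  pose (Hl := fun w => proj2_sig (constructive_indefinite_description _ (loc w))).
  destruct (agree_finite_cover l) as [L HL]. exists L. intros z z' A.
  destruct (HL z z' A) as [w [wz wz']].
  apply Hl, Rabs_def2 in wz. apply Hl, Rabs_def2 in wz'. apply Rabs_def1; lra.
Qed.

(** Here [V (Some g)] is the set of points at which the bit [code z g] is forbidden. These sets and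
    [U] cover [X]; a code agreeing with that of [z] on the [g] of a finite subcover must have its
    point in [U]. *)
Lemma point_continuous : continuous cover_open opX point.
Proof.
  intros U oU z Uz.
  pose (V := fun i : option (C opX) => match i with
    | None => U
    | Some g => fun y => if code z g then proj1_sig g y < -1 else 1 < proj1_sig g y
    end).
  destruct (compact_finite_subfamily opX V cptX) as [k kcov].
  - intros [g|]; simpl; [|easy]. destruct (code z g).
    + apply (proj2_sig g _ (R_open_lt _)).
    + apply (proj2_sig g _ (R_open_gt _)).
  - intros y. destruct (classic (y = point z)) as [->|neq]; [now exists None|].
    destruct (separating_function _ _ neq) as [g [gy gz]].
    exists (Some g). simpl. assert (H := proj2_sig z g).
    fold (code z) in H. fold (point z) in H. destruct (code z g); lra.
  - exists (flat_map (fun i => match i with Some g => g :: nil | None => nil end) k).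
    intros z' A. destruct (kcov (point z')) as [[g|] [kg Vz']]; [exfalso|easy].
    assert (E : code z' g = code z g).
    { apply A, in_flat_map. exists (Some g). split; [easy | now left]. }
    simpl in Vz'. rewrite <- E in Vz'. assert (H := proj2_sig z' g).
    fold (code z') in H. fold (point z') in H. destruct (code z' g); lra.
Qed.

(** * Densities on the fibres and continuity of the measure *)

(* A continuous decreasing bijection onto (0, 1): a true bit at [g] has density
   >= c iff - threshold c <= g x, a false one iff g x <= threshold c. *)
Definition threshold (c : R) : R := / (1 + exp c).

Lemma threshold_lt c c' : c' < c -> threshold c < threshold c'.
Proof.
  intros cc. apply exp_increasing in cc. assert (H := exp_pos c').
  apply Rinv_lt_contravar; [apply Rmult_lt_0_compat|]; lra.
Qed.

Lemma threshold_le c c' : c' <= c -> threshold c <= threshold c'.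
Proof. intros [cc| ->]; [left; now apply threshold_lt | lra]. Qed.

Lemma threshold_pos c : 0 < threshold c.
Proof. apply Rinv_0_lt_compat. assert (H := exp_pos c). lra. Qed.

Lemma threshold_lt_1 c : threshold c < 1.
Proof.
  rewrite <- Rinv_1. assert (H := exp_pos c). apply Rinv_lt_contravar; lra.
Qed.

Definition cover_point x b u (u1 : u <= 1) (H : level u x b) : cover :=
  exist _ (x, b) (level_mono u 1 x b u1 H).

(** This reads c <= lambda_x z, with lambda_x equal to -oo off the fibre; the larger [c], the
    smaller the slack granted to the code. *)
Definition fibre_level (x : X) (c : R) (z : cover) : Prop :=
  point z = x /\ level (threshold c) x (code z).

Lemma fibre_level_anti x c c' z : c' <= c -> fibre_level x c z -> fibre_level x c' z.
Proof.
  intros cc [zx H]. split; [easy|]. exact (level_mono _ _ _ _ (threshold_le _ _ cc) H).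
Qed.

(** The sign code of [x] serves for all [c]: its density is +oo. *)
Lemma fibre_level_inh x c : exists z, fibre_level x c z.
Proof.
  assert (H : level (threshold c) x (sign_code x)).
  { apply level_sign_code. left. apply threshold_pos. }
  exists (cover_point x _ _ (Rlt_le _ _ (threshold_lt_1 c)) H). now split.
Qed.

(** Lowering [c] by [e] pays for two things: it enlarges the slack, so that the bits on [l] remain
    allowed at [y], and it absorbs the change of [phi] when the other bits are reset. *)
Lemma fibre_hypo_patch (phi : C cover_open) e l c x y :
  0 < e ->
  (forall z z', agree l z z' -> Rabs (proj1_sig phi z' - proj1_sig phi z) < e) ->
  (forall g, In g l ->
     Rabs (proj1_sig g y - proj1_sig g x) < threshold (c - e) - threshold c) ->
  density_hypo (fibre_level x) (proj1_sig phi) c ->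
  density_hypo (fibre_level y) (proj1_sig phi) (c - e).
Proof.
  intros e0 unif near [z [[zx lev] cz]].
  destruct (level_patch _ (threshold (c - e)) x y (code z) l
    (Rlt_le _ _ (threshold_pos _)) lev near) as [b [lev' bl]].
  exists (cover_point y b _ (Rlt_le _ _ (threshold_lt_1 _)) lev').
  split; [now split|].
  specialize (unif z (cover_point y b _ (Rlt_le _ _ (threshold_lt_1 _)) lev') bl).
  apply Rabs_def2 in unif. lra.
Qed.

(** The closeness condition is symmetric in [x] and [y], so one [V] serves both directions. It
    depends on [c], since the gap between thresholds shrinks to 0 for large |c|. *)
Lemma fibre_hypo_near (phi : C cover_open) e c x :
  0 < e -> exists V, opX V /\ V x /\ forall y, V y ->
    (density_hypo (fibre_level x) (proj1_sig phi) c ->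
     density_hypo (fibre_level y) (proj1_sig phi) (c - e)) /\
    (density_hypo (fibre_level y) (proj1_sig phi) c ->
     density_hypo (fibre_level x) (proj1_sig phi) (c - e)).
Proof.
  intros e0. destruct (cover_uniform phi e e0) as [l unif].
  exists (fun y => forall g, In g l ->
    Rabs (proj1_sig g y - proj1_sig g x) < threshold (c - e) - threshold c).
  split; [|split].
  - apply (open_finite_inter opX (fun g y =>
      Rabs (proj1_sig g y - proj1_sig g x) < threshold (c - e) - threshold c)); [easy|].
    intros g. apply continuous_open_ball.
  - intros g _. rewrite Rminus_diag, Rabs_R0.
    assert (threshold c < threshold (c - e)) by (apply threshold_lt; lra). lra.
  - intros y near. split; apply fibre_hypo_patch with l; auto.
    intros g lg. rewrite Rabs_minus_sym. auto.
Qed.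

Definition fibre_measure (x : X) : J cover_open :=
  density_measure cover_open (fibre_level x) cover_compact
    (fibre_level_anti x) (fibre_level_inh x).

Lemma fibre_measure_gt x phi c :
  c < proj1_sig (fibre_measure x) phi ->
  density_hypo (fibre_level x) (proj1_sig phi) c.
Proof. apply density_hypo_below, fibre_level_anti. Qed.

Lemma fibre_measure_ge x phi c :
  density_hypo (fibre_level x) (proj1_sig phi) c ->
  c <= proj1_sig (fibre_measure x) phi.
Proof. apply density_sup_ge. Qed.

Lemma fibre_measure_continuous : continuous opX (J_open cover_open) fibre_measure.
Proof.
  apply continuous_to_J; [easy|]. intros phi U oU.
  apply open_of_local; [easy|]. intros x Ux.
  destruct (oU _ Ux) as [e [e0 eU]].
  set (m := proj1_sig (fibre_measure x) phi) in *.
  (* Two values of [c] suffice. Carrying [m - e / 3] from [x] to [y] bounds the value at [y] below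
     by [m - 2 * e / 3]; if that value were at least [m + e], carrying [m + 2 * e / 3] back to [x]
     would give at least [m + e / 3] there. *)
  destruct (fibre_hypo_near phi (e / 3) (m - e / 3) x) as [V [oV [Vx HV]]]; [lra|].
  destruct (fibre_hypo_near phi (e / 3) (m + 2 * e / 3) x) as [W [oW [Wx HW]]]; [lra|].
  exists (fun y => V y /\ W y). split; [now apply topX | split; [easy|]].
  intros y [Vy Wy]. apply eU.
  apply HV in Vy. apply HW in Wy. destruct Vy as [Vy _]. destruct Wy as [_ Wy].
  apply Rabs_def1.
  - apply Rnot_le_lt. intros far.
    assert (Hx : density_hypo (fibre_level x) (proj1_sig phi) (m + 2 * e / 3 - e / 3)).
    { apply Wy. apply fibre_measure_gt. lra. }
    apply fibre_measure_ge in Hx. fold m in Hx. lra.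
  - assert (Hy : density_hypo (fibre_level y) (proj1_sig phi) (m - e / 3 - e / 3)).
    { apply Vy. apply fibre_measure_gt. fold m. lra. }
    apply fibre_measure_ge in Hy. lra.
Qed.

Lemma fibre_closed x : cover_open (fun z => ~ point z = x).
Proof.
  apply (point_continuous (fun y => y <> x)).
  apply open_of_local; [easy|]. intros y yx.
  destruct (hausX y x yx) as [U [V [oU [_ [Uy [Vx UV]]]]]].
  exists U. split; [easy | split; [easy|]]. intros w Uw ->. eauto.
Qed.

Lemma point_milyutin : maxmin_milyutin cover_open opX point.
Proof.
  split; [apply point_continuous|split].
  - intros x. destruct (fibre_level_inh x 0) as [z [zx _]]. now exists z.
  - exists fibre_measure. split; [apply fibre_measure_continuous|].
    intros x. apply density_measure_support; [apply fibre_closed | now intros c z []].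
Qed.

End Construction.

Theorem mainTheorem7 (X : Type) (opX : (X -> Prop) -> Prop) :
  is_topology opX -> compact_sp opX -> hausdorff opX ->
  exists (Z : Type) (opZ : (Z -> Prop) -> Prop),
    is_topology opZ /\ compact_sp opZ /\ hausdorff opZ /\ zero_dimensional opZ /\
    exists f : Z -> X, maxmin_milyutin opZ opX f.
Proof.
  intros top cpt haus. exists (cover opX), (cover_open opX).
  split; [apply cover_topology|].
  split; [now apply cover_compact|].
  split; [now apply cover_hausdorff|].
  split; [apply cover_zero_dimensional|].
  exists (point opX). now apply point_milyutin.
Qed.
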